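(* Let $t$ and $\ell$ be positive integers with $4\mid t$ and $9\mid \ell$. Then for all integers $n\ge0$: \[ \overline{p}_{2t}(4n+2)\equiv 0\pmod{4}, \] \[ \overline{p}_{2t}(4n+3)\equiv 0\pmod{8}, \] \[ \overline{p}_{3\ell}(9n+3j)\equiv 0\pmod{8}\quad\text{for } j=1,2. \]
   Context: For $k\ge1$ let $f_k=\prod_{m\ge1}(1-q^{km})$. For an integer $\ell\ge1$, $\overline{p}_\ell(n)$ denotes the number of 2-color overpartitions of $n$ (the first occurrence of a part of each color may be overlined) in which one of the two colors appears only in parts that are multiples of $\ell$; its generating function is $\sum_{n\ge0}\overline{p}_\ell(n)q^n=\dfrac{f_2f_{2\ell}}{f_1^2f_\ell^2}$. *)

(* Defs.v *)
From mathcomp Require Import all_boot.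

Set Implicit Arguments.
Unset Strict Implicit.
Unset Printing Implicit Defensive.

(* Frequency representation: lam (c, i) = (m, o) means that the part of size
   i.+1 and color c occurs m times, and that its first occurrence is overlined
   iff o.  The colors are the two booleans.  Bounding sizes and multiplicities
   by n loses nothing for overpartitions of n, since parts are positive. *)
Definition frequencies (n : nat) := {ffun bool * 'I_n -> 'I_n.+1 * bool}.

Definition multiplicity (n : nat) (lam : frequencies n) (c : bool) (i : 'I_n)
  : nat := (lam (c, i)).1.

Definition overlined (n : nat) (lam : frequencies n) (c : bool) (i : 'I_n)
  : bool := (lam (c, i)).2.

Definition total_size (n : nat) (lam : frequencies n) : nat :=
  \sum_(c : bool) \sum_(i < n) multiplicity lam c i * i.+1.

Definition is_overpartition (n : nat) (lam : frequencies n) : bool :=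
  (total_size lam == n) &&
  [forall c, forall i, overlined lam c i ==> (0 < multiplicity lam c i)].

(* The color [true] is the one restricted to multiples of l. *)
Definition restricted (n : nat) (lam : frequencies n) (l : nat) : bool :=
  [forall i, (0 < multiplicity lam true i) ==> (l %| i.+1)].

Definition overp (l n : nat) : nat :=
  #|[set lam : frequencies n | is_overpartition lam & restricted lam l]|.

(* Main.v *)
(** The generating function of overpartitions is the product over d of
    (1 + q^d) / (1 - q^d) = 1 + 2 g_d with g_d = q^d + q^(2d) + ...  Modulo 8
    it equals 1 + 2 e_1 + 4 e_2 in the elementary symmetric functions of the
    g_d, where e_1 = sum tau(k) q^k and 2 e_2 = e_1^2 - sum g_d^2, the last sum
    having coefficients sigma(k) - tau(k).  If k is not a sum of two squares,
    then tau(k) is even and the coefficient of q^k in e_1^2 is divisible by 4;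
    if moreover 4 divides sigma(k), the coefficient of q^k is 0 modulo 8.  This
    covers k = 3 mod 4 and the k divisible exactly once by 3.  The second color
    contributes a power series in q^l, which preserves residue classes mod l. *)
Require Import Defs.
From mathcomp Require Import all_boot all_algebra ring zify.

Set Implicit Arguments.
Unset Strict Implicit.
Unset Printing Implicit Defensive.

Import GRing.Theory.

Local Open Scope nat_scope.

(** * Parity and divisibility of divisor sums *)

Lemma sum_sym_nat N (F : nat -> nat -> nat) :
    (forall i j, F i j = F j i) ->
  \sum_(i < N) \sum_(j < N) F i j =
    \sum_(i < N) F i i + 2 * \sum_(i < N) \sum_(j < i) F i j.
Proof.
move=> symF; elim: N => [|N IH]; first by rewrite !big_ord0.
under eq_bigr do rewrite big_ord_recr /=.
rewrite big_split !big_ord_recr /= IH.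
have -> : \sum_(i < N) F i N = \sum_(i < N) F N i by apply: eq_bigr => i _.
ring.
Qed.

Lemma sum_eqn_mul N x (F : nat -> nat) :
  \sum_(i < N) (i == x :> nat) * F i = (x < N) * F x.
Proof.
rewrite (eq_bigr (fun i : 'I_N => if i == x :> nat then F i else 0)) => [|i _].
  by rewrite -big_mkcond big_ord1_eq; case: ifP => _; rewrite ?mul1n.
by case: ifP => _; rewrite ?mul1n.
Qed.

(* tau(k) and sigma(k) respectively, when 0 < k <= N. *)
Definition ndivs N k := \sum_(i < N) \sum_(j < N) (i.+1 * j.+1 == k : nat).

Definition sumdivs N k :=
  \sum_(i < N) \sum_(j < N) (i.+1 * j.+1 == k) * j.+1.

(** Swapping the two factors of [k] is an involution, and a fixed point would make [k] a square. *)
Lemma ndivs_even N k : (forall a, a * a != k) -> 2 %| ndivs N k.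
Proof.
move=> nsq; rewrite /ndivs (sum_sym_nat _ (F := fun i j => i.+1 * j.+1 == k)).
  by rewrite big1 ?dvdn_mulr // => i _; rewrite (negbTE (nsq _)).
by move=> i j; rewrite mulnC.
Qed.

(** Pair each divisor with its cofactor: a product that is 3 mod 4 has factors congruent to 1 and 3,
    whose sum is 0 mod 4. *)
Lemma sumdivs_mod4_3 N k : k %% 4 = 3 -> 4 %| sumdivs N k.
Proof.
move=> k3; have nsq a : a * a != k.
  by apply/eqP=> ak; move: k3; rewrite -ak -modnMm; have:= ltn_pmod a (isT : 0 < 4);
     case: (a %% 4) => [|[|[|[|]]]].
have -> : sumdivs N k = \sum_(i < N) \sum_(j < i) (i.+1 * j.+1 == k) * (i.+1 + j.+1).
  (* After doubling, one copy of [sumdivs] is read with [i] and [j] exchanged, so the summand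
     becomes the symmetric [i.+1 + j.+1]. *)
  apply/eqP; rewrite -(@eqn_pmul2l 2) //; apply/eqP.
  pose F i j := (i.+1 * j.+1 == k) * (i.+1 + j.+1).
  have symF i j : F i j = F j i by rewrite /F mulnC [i.+1 * _]mulnC [_ + j.+1]addnC mulnC.
  have := sum_sym_nat N symF.
  rewrite [X in _ = X + _]big1 => [|i _]; last by rewrite /F (negbTE (nsq _)).
  rewrite add0n => <-; rewrite mul2n -addnn {2}/sumdivs exchange_big -big_split /=.
  apply: eq_bigr => i _; rewrite -big_split /=; apply: eq_bigr => j _.
  by rewrite /F [j.+1 * _]mulnC; lia.
apply: dvdn_sum => i _; apply: dvdn_sum => j _.
case: eqP => [ijk|]; rewrite ?mul1n // /dvdn -modnDm.
move: k3; rewrite -ijk -modnMm.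
have := ltn_pmod i.+1 (isT : 0 < 4); have := ltn_pmod j.+1 (isT : 0 < 4).
by case: (i.+1 %% 4) => [|[|[|[|]]]] //; case: (j.+1 %% 4) => [|[|[|[|]]]].
Qed.

Lemma sumdivsE N k : 0 < k <= N -> sumdivs N k = \sum_(d <- divisors k) d.
Proof.
move=> /andP[k_gt0 kN]; rewrite /sumdivs exchange_big /=.
transitivity (\sum_(j < N) (j.+1 %| k) * j.+1).
  apply: eq_bigr => j _; case: dvdnP => [[q kq]|ndvd]; last first.
    by rewrite big1 // => i _; case: eqP => // ijk; case: ndvd; exists i.+1.
  rewrite -big_distrl /=; congr (_ * _).
  rewrite (eq_bigr (fun i : 'I_N => (i == q.-1 :> nat) * 1)) => [|i _].
    by rewrite (sum_eqn_mul _ _ (fun _ => 1)) muln1 (_ : q.-1 < N) //; nia.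
  by rewrite muln1 kq eqn_pmul2r //; congr nat_of_bool; case: q kq => //; lia.
rewrite -(big_mkord xpredT (fun j => (j.+1 %| k) * j.+1)).
rewrite -(big_add1 _ _ 0 N.+1 xpredT (fun j => (j %| k) * j)) /index_iota subSS subn0.
rewrite (eq_bigr (fun j => if j %| k then j else 0)) => [|j _]; last first.
  by case: ifP; rewrite ?mul1n.
rewrite -big_mkcond -big_filter; apply: perm_big; apply: uniq_perm.
- by rewrite filter_uniq ?iota_uniq.
- exact: divisors_uniq.
move=> d; rewrite mem_filter mem_iota -dvdn_divisors //.
case: (boolP (d %| k)) => //= dk.
by have := dvdn_leq k_gt0 dk; have := dvdn_gt0 k_gt0 dk; lia.
Qed.

Lemma sum_divisors_mul3 u : 0 < u -> ~~ (3 %| u) ->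
  \sum_(d <- divisors (3 * u)) d = 4 * \sum_(d <- divisors u) d.
Proof.
move=> u_gt0 u3.
rewrite (perm_big (divisors u ++ map (muln 3) (divisors u))) /=.
  by rewrite big_cat big_map -big_distrr /=; lia.
apply: uniq_perm; first exact: divisors_uniq.
  rewrite cat_uniq divisors_uniq map_inj_uniq ?divisors_uniq ?andbT //=.
    apply/hasPn => _ /mapP[d _ ->]; rewrite /= -dvdn_divisors //.
    by apply: contra u3; apply: dvdn_trans; rewrite dvdn_mulr.
  by move=> x y; lia.
move=> d; rewrite mem_cat -!dvdn_divisors ?muln_gt0 //.
have c3 x : ~~ (3 %| x) -> coprime x 3.
  by move=> x3; rewrite coprime_sym prime_coprime.
apply/idP/orP => [|[/dvdn_mull-> //|/mapP[e]]]; last first.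
  by rewrite -dvdn_divisors // => eu ->; rewrite dvdn_pmul2l.
have [/dvdnP[e ->]|d3] := boolP (3 %| d).
  rewrite mulnC dvdn_pmul2l // => eu; right.
  by apply: map_f; rewrite -dvdn_divisors.
by rewrite Gauss_dvdr ?c3 //; left.
Qed.

(** Each product [f i * f j] with [i + j = k] is even, since [i] and [j] are not both squares. Off
    the diagonal the terms occur twice; on it both factors are even. *)
Lemma convolution_mod4 (f : nat -> nat) k :
    (forall a, (forall b, b * b != a) -> 2 %| f a) ->
    (forall a b, a * a + b * b != k) ->
  4 %| \sum_(i < k.+1) f i * f (k - i).
Proof.
move=> evf nsum.
pose F i j := (i + j == k) * (f i * f j).
have -> : \sum_(i < k.+1) f i * f (k - i) = \sum_(i < k.+1) \sum_(j < k.+1) F i j.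
  apply: eq_bigr => i _.
  rewrite (eq_bigr (fun j : 'I_k.+1 => (j == k - i :> nat) * (f i * f j))).
    by rewrite (sum_eqn_mul _ _ (fun j => f i * f j)) ltnS leq_subr mul1n.
  by move=> j _; rewrite /F; congr (nat_of_bool _ * _); have := ltn_ord i; lia.
have dvdF i j : 2 %| F i j.
  rewrite /F; case: eqP => // ijk; rewrite mul1n.
  have [/existsP[[a /= _] /eqP ai]|/existsPn nex] :=
      boolP [exists a : 'I_i.+1, a * a == i].
    apply: dvdn_mull; apply: evf => b; apply/eqP => bj.
    by move: (nsum a b); rewrite ai bj ijk eqxx.
  apply: dvdn_mulr; apply: evf => b; apply/eqP => bi.
  have bi' : b < i.+1 by nia.
  by have := nex (Ordinal bi'); rewrite /= bi eqxx.
rewrite sum_sym_nat; last by move=> i j; rewrite /F addnC [f i * _]mulnC.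
rewrite dvdn_add //; last first.
  rewrite (@dvdn_pmul2l 2 2 _) //.
  by apply: dvdn_sum => i _; apply: dvdn_sum => j _.
apply: dvdn_sum => i _; rewrite /F; case: eqP => // iik; rewrite mul1n.
by apply: (dvdn_mul (d1 := 2) (d2 := 2)); apply: evf => b; apply/eqP => bi;
   move: (nsum b b); rewrite bi iik eqxx.
Qed.

(** * Truncated generating series of one color, modulo 8 *)

Section Series.
Local Open Scope ring_scope.

(** Here [e] is the second elementary symmetric function and [h] collects the higher ones. Writing
    the square as a sum avoids subtraction, so the identity holds over [{poly nat}]. *)
Lemma prod_1D2_expand (R : comNzSemiRingType) (I : Type) (r : seq I) (g : I -> R) :
  exists e h, (\sum_(i <- r) g i) ^+ 2 = \sum_(i <- r) g i ^+ 2 + e *+ 2 /\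
    \prod_(i <- r) (1 + g i *+ 2) = 1 + (\sum_(i <- r) g i) *+ 2 + e *+ 4 + h *+ 8.
Proof.
elim: r => [|i r [e [h [Ee Eh]]]].
  by exists 0, 0; rewrite !big_nil; split; ring.
rewrite !big_cons Eh.
exists (e + g i * \sum_(j <- r) g j), (h + (h *+ 2 + e) * g i).
split; last by ring.
by rewrite sqrrD Ee; ring.
Qed.

(* Truncation of q^d / (1 - q^d), where d = i.+1. *)
Definition multiples N (i : nat) : {poly nat} := \sum_(j < N) 'X^(i.+1 * j.+1).

Definition overpartitions N : {poly nat} :=
  \prod_(i < N) (1 + multiples N i *+ 2).

Lemma coef_sum_multiples N k : (\sum_(i < N) multiples N i)`_k = ndivs N k.
Proof.
rewrite coef_sum; apply: eq_bigr => i _; rewrite coef_sum; apply: eq_bigr => j _.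
by rewrite coefXn natrE eq_sym.
Qed.

(** For [d] dividing [k > 0], the coefficient of [q^k] in the square of [q^d / (1 - q^d)] is
    [k / d - 1], the number of ways to write [k / d] as an ordered sum of two positive integers. The
    bound on [k] makes the truncation harmless. *)
Lemma coef_sum_sqr_multiples N k : (k <= N)%N ->
  (((\sum_(i < N) multiples N i ^+ 2)`_k)%R + ndivs N k = sumdivs N k)%N.
Proof.
move=> kN; rewrite coef_sum -big_split /=; apply: eq_bigr => i _.
transitivity (\sum_(j < N) \sum_(j' < N) (i.+1 * j.+1 + i.+1 * j'.+1 == k)
   + \sum_(j < N) (i.+1 * j.+1 == k))%N.
  congr (_ + _)%N; rewrite expr2 /multiples mulr_suml coef_sum; apply: eq_bigr => j _.
  rewrite mulr_sumr coef_sum; apply: eq_bigr => j' _.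
  by rewrite -exprD coefXn natrE eq_sym.
have [/dvdnP[M kM]|ndvd] := boolP (i.+1 %| k)%N; last first.
  have nk x : (i.+1 * x == k)%N = false.
    by apply: contraNF ndvd => /eqP<-; rewrite dvdn_mulr.
  rewrite !big1 // => j _; rewrite ?nk // big1 // => j' _.
  by rewrite -mulnDr nk.
have MN : (M <= N)%N by nia.
have Ej x : (i.+1 * x == k)%N = (x == M) by rewrite kM mulnC eqn_pmul2r.
under eq_bigr => j _ do under eq_bigr => j' _ do rewrite -mulnDr Ej.
under [X in (_ + X)%N]eq_bigr => j _ do rewrite Ej.
under [RHS]eq_bigr => j _ do rewrite Ej.
case: M {kM Ej} MN => [|M] MN.
  by rewrite !big1 // => j _; rewrite big1.
rewrite (sum_eqn_mul _ _ succn) MN mul1n.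
under [X in (_ + X)%N]eq_bigr => j _ do rewrite eqSS -[nat_of_bool _]muln1.
rewrite (sum_eqn_mul _ _ (fun=> 1%N)) MN addn1; congr _.+1.
(* From [j.+1 + j'.+1 = M.+1], the index [j'] is [M - j.+1], which is a genuine solution only when
   [j < M]. *)
transitivity (\sum_(j < N) (j < M))%N.
  apply: eq_bigr => j _.
  rewrite (eq_bigr (fun j' : 'I_N => (j' == (M - j.+1)%N :> nat) * (j < M))%N) => [|j' _].
    by rewrite (sum_eqn_mul _ _ (fun=> (j < M)%N : nat)); lia.
  by case: (ltnP j M) => ?; rewrite ?muln1 ?muln0; lia.
by rewrite -big_mkcond /= -(big_ord_widen _ (fun=> 1%N)) ?sum1_card ?card_ord // ltnW.
Qed.

Lemma coef_overpartitions (N k : nat) : (k <= N)%N ->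
  exists e h : nat,
    (\sum_(i < k.+1) ndivs N i * ndivs N (k - i) + ndivs N k
      = sumdivs N k + 2 * e)%N /\
    (overpartitions N)`_k = ((k == 0) + 2 * ndivs N k + 4 * e + 8 * h)%N.
Proof.
move=> kN; have [e [h [Ee Eh]]] :=
  prod_1D2_expand (index_enum 'I_N) (fun i : 'I_N => multiples N i).
exists e`_k, h`_k; split.
  rewrite -(coef_sum_sqr_multiples kN) addnAC; congr (_ + _)%N.
  transitivity (((\sum_(i < N) multiples N i) ^+ 2)`_k).
    rewrite expr2 coefM; apply: eq_bigr => i _.
    by rewrite !coef_sum_multiples natrE.
  by rewrite Ee !coefD !natrE mul2n -addnn.
rewrite /overpartitions Eh !coefD coef1 !coef_sum_multiples !natrE.
by rewrite !mulSn !mul0n !addn0.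
Qed.

Lemma overpartitions_mod4 N k : (k <= N)%N -> (forall a, a * a != k)%N ->
  (4 %| ((overpartitions N)`_k)%R)%N.
Proof.
move=> kN nsq; have [e [h [_ ->]]] := coef_overpartitions kN.
have := ndivs_even N nsq; have := nsq 0%N; lia.
Qed.

(** Eliminating [e] turns [2 * tau + 4 * e] into twice the convolution plus [4 * tau] minus
    [2 * sigma], and 8 divides each of the three. *)
Lemma overpartitions_mod8 N k : (k <= N)%N ->
    (forall a b, a * a + b * b != k)%N -> (4 %| sumdivs N k)%N ->
  (8 %| ((overpartitions N)`_k)%R)%N.
Proof.
move=> kN nsum dvdS; have [e [h [Ee ->]]] := coef_overpartitions kN.
have nsq a : (a * a != k)%N by have := nsum a 0%N; rewrite addn0.
have := convolution_mod4 (@ndivs_even N) nsum.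
have := ndivs_even N nsq; have := nsq 0%N; lia.
Qed.

(** * The combinatorial count as a coefficient of a product *)

Lemma prod_if_0 (R : comNzSemiRingType) (I : finType) (P : pred I) (F : I -> R) :
  \prod_i (if P i then F i else 0) = if [forall i, P i] then \prod_i F i else 0.
Proof.
case: forallP => [Pall|/forallP/forallPn[i nPi]].
  by apply: eq_bigr => i _; rewrite Pall.
by rewrite (bigD1 i) //= (negbTE nPi) mul0r.
Qed.

(** Distributing the product over pairs (color, size) gives one monomial per frequency function;
    inadmissible local choices get weight 0. *)
Lemma overp_coef l n :
  overp l n = (overpartitions n *
    \prod_(i < n | (l %| i.+1)%N) (1 + multiples n i *+ 2))`_n.
Proof.
pose ok (x : bool * 'I_n) (y : 'I_n.+1 * bool) :=
  (y.2 ==> (0 < y.1)%N) && ((x.1 && (0 < y.1)%N) ==> (l %| x.2.+1)%N).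
pose w x y : {poly nat} := if ok x y then 'X^(y.1 * x.2.+1) else 0.
have w_sum x : \sum_y w x y =
    if x.1 ==> (l %| x.2.+1)%N then 1 + multiples n x.2 *+ 2 else 1.
  (* Multiplicity 0 forbids an overline and gives 1; each positive multiplicity allows both overline
     states, whence the factor 2. *)
  rewrite -(pair_bigA _ (fun m o => w x (m, o))) /= big_ord_recl /= big_bool /w /ok /=.
  rewrite andbF /= mul0n add0r.
  case: ifP => xl; last first.
    rewrite big1 ?addr0 // => i _.
    by rewrite big_bool /= andbT xl addr0.
  congr (_ + _); rewrite -sumrMnl; apply: eq_bigr => i _.
  by rewrite big_bool /= andbT xl /= mulnC.
transitivity ((\prod_x \sum_y w x y)`_n).
  rewrite bigA_distr_bigA coef_sum /overp -sum1_card big_mkcond /=.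
  apply: eq_bigr => lam _; rewrite inE prod_if_0.
  rewrite /is_overpartition /restricted.
  have -> : [forall x, ok x (lam x)] =
     [forall c, forall i, overlined lam c i ==> (0 < multiplicity lam c i)%N] &&
     [forall i, (0 < multiplicity lam true i)%N ==> (l %| i.+1)%N].
    apply/forallP/andP => [okx|[/forallP ov /forallP re] [c i]].
      split; last by apply/forallP => i; have /andP[] := okx (true, i).
      by apply/forallP => c; apply/forallP => i; have /andP[] := okx (c, i).
    apply/andP; split; first exact: (forallP (ov c) i).
    by case: c => //=; exact: re.
  have -> : total_size lam = (\sum_x (lam x).1 * x.2.+1)%N.
    rewrite /total_size (pair_bigA _ (fun c i => multiplicity lam c i * i.+1)%N).
    by apply: eq_bigr => -[c i] _.
  rewrite -andbA; case: ([forall c, _] && _) => /=; last by rewrite andbF coef0.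
  by rewrite -expr_sum coefXn natrE andbT eq_sym; case: eqP.
rewrite (eq_bigr _ (fun x _ => w_sum x)).
rewrite -(pair_bigA _ (fun c (i : 'I_n) =>
  if c ==> (l %| i.+1)%N then 1 + multiples n i *+ 2 else 1)) /=.
by rewrite big_bool /= mulrC -big_mkcond.
Qed.

Lemma coef_prod_multiples_eq0 l N k : ~~ (l %| k)%N ->
  (\prod_(i < N | (l %| i.+1)%N) (1 + multiples N i *+ 2))`_k = 0.
Proof.
move: k; apply: (big_ind (fun p : {poly nat} => forall k, ~~ (l %| k)%N -> p`_k = 0)).
- by move=> k; rewrite coef1; case: eqP => // ->; rewrite dvdn0.
- move=> p q Hp Hq k lk; rewrite coefM big1 // => i _.
  have [li|/Hp->] := boolP (l %| i)%N; last by rewrite mul0r.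
  rewrite Hq ?mulr0 //; apply: contra lk => lki.
  by rewrite -(subnKC (ltn_ord i : i <= k)%N) dvdn_add.
move=> i li k lk; rewrite coefD coefMn coef1 coef_sum big1 ?mul0rn ?addr0.
  by case: eqP lk => // ->; rewrite dvdn0.
move=> j _; rewrite coefXn; case: eqP lk => // ->.
by rewrite dvdn_mulr.
Qed.

(** The restricted color only has exponents divisible by [l], so only first-color exponents
    congruent to [n] mod [l] survive in the convolution. *)
Lemma dvdn_overp d l n :
    (forall k, k <= n -> k = n %[mod l] -> d %| ((overpartitions n)`_k)%R)%N ->
  (d %| overp l n)%N.
Proof.
move=> dvdA; rewrite overp_coef coefM; apply: dvdn_sum => i _; rewrite natrE.
have [lni|lni] := boolP (l %| n - i)%N; last first.
  by rewrite coef_prod_multiples_eq0 // natrE muln0.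
apply: dvdn_mulr; apply: dvdA; first by rewrite -ltnS.
by apply/eqP; rewrite eq_sym eqn_mod_dvd // -ltnS.
Qed.

End Series.

Theorem corollary3p1 (t l : nat) (t_gt0 : 0 < t) (l_gt0 : 0 < l)
    (dvd4t : 4 %| t) (dvd9l : 9 %| l) (n : nat) :
  [/\ overp (2 * t) (4 * n + 2) = 0 %[mod 4],
      overp (2 * t) (4 * n + 3) = 0 %[mod 8]
    & forall j : nat, j \in [:: 1; 2] ->
        overp (3 * l) (9 * n + 3 * j) = 0 %[mod 8]].
Proof.
have sq_mod4 a : a * a %% 4 \in [:: 0; 1].
  by rewrite -modnMm; have := ltn_pmod a (isT : 0 < 4);
     case: (a %% 4) => [|[|[|[|]]]].
have mod_dvd d m k x : d %| m -> k = x %[mod m] -> k = x %[mod d].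
  by move=> dm kx; rewrite -(modn_dvdm k dm) kx modn_dvdm.
have dvd8 : 4 %| 2 * t by rewrite dvdn_mull.
have dvd27 : 9 %| 3 * l by rewrite dvdn_mull.
have mod0 d m : d %| m -> m = 0 %[mod d] by move=> /eqP->; rewrite mod0n.
split=> [||j jin]; apply: mod0; apply: dvdn_overp => k kn.
- move=> /(mod_dvd _ _ _ _ dvd8) k2; apply: overpartitions_mod4 => // a.
  by apply/eqP => ak; have := sq_mod4 a; rewrite !inE ak; lia.
- move=> /(mod_dvd _ _ _ _ dvd8) k3; apply: overpartitions_mod8 => // [a b|].
    by apply/eqP; have := sq_mod4 a; have := sq_mod4 b; rewrite !inE; lia.
  by apply: sumdivs_mod4_3; lia.
move=> /(mod_dvd _ _ _ _ dvd27) kj.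
have k3 : 3 %| k by move: jin; rewrite !inE; lia.
have k9 : ~~ (9 %| k) by move: jin; rewrite !inE; lia.
have k_gt0 : 0 < k by case: (k) k9.
apply: overpartitions_mod8 => // [a b|].
  (* Squares are 0 or 1 mod 3, so 3 dividing [a * a + b * b] forces it to divide [a] and [b], and
     then 9 divides [k]. *)
  apply: contraNneq k9 => abk; move: k3; rewrite -abk => ab3.
  have [a3 b3] : 3 %| a /\ 3 %| b.
    move: ab3; rewrite /dvdn -modnDm -(modnMm a) -(modnMm b).
    have := ltn_pmod a (isT : 0 < 3); have := ltn_pmod b (isT : 0 < 3).
    by case: (a %% 3) => [|[|[|]]] //; case: (b %% 3) => [|[|[|]]].
  by rewrite dvdn_add // (dvdn_mul (d1 := 3) (d2 := 3)).
(* Write [k = 3 * u] with [u] prime to 3: the factor 4 of [sigma(k)] is [sigma(3)]. *)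
rewrite sumdivsE ?k_gt0 //; case/dvdnP: k3 k9 k_gt0 => u ->.
rewrite mulnC (@dvdn_pmul2l 3 3) // muln_gt0 /= => u3 u_gt0.
by rewrite sum_divisors_mul3 // dvdn_mulr.
Qed.
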